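(* For $t\in\mathbb{R}$ let $S_{t}g(\omega):=g(\omega-t)$ be the semigroup of composition operators defined on $B_{\infty,\circ}(\mathbb{U},i)$. Then $(S_{t})_{t\in\mathbb{R}}$ is a strongly continuous group of isometries on $B_{\infty,\circ}(\mathbb{U},i)$.
   Context: $\mathbb{U}=\{\omega\in\mathbb{C}:\Im(\omega)>0\}$ is the upper half plane and $\mathcal{H}(\mathbb{U})$ is the space of analytic functions on $\mathbb{U}$. The little Bloch space is $B_{\infty,\circ}(\mathbb{U})=\{f\in\mathcal{H}(\mathbb{U}):\lim_{\Im(\omega)\to0}\Im(\omega)|f'(\omega)|=0\}$, with the norm of the Bloch space $B_\infty(\mathbb{U})=\{f\in\mathcal H(\mathbb{U}):\sup_{\omega\in\mathbb{U}}\Im(\omega)|f'(\omega)|<\infty\}$, namely $\|f\|_{B_\infty(\mathbb{U})}=|f(i)|+\sup_{\omega\in\mathbb{U}}\Im(\omega)|f'(\omega)|$. Its subspace $B_{\infty,\circ}(\mathbb{U},i)=\{f\in B_{\infty,\circ}(\mathbb{U}):f(i)=0\}$ is equipped with the norm $\|f\|=\sup_{\omega\in\mathbb{U}}\Im(\omega)|f'(\omega)|$.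
   Formalization: As g(ω−t) need not vanish at i, S_t is taken as g(ω−t)−g(i−t) on the space of functions vanishing at i, and as g(ω−t) on the whole little Bloch space with the sup seminorm; little Bloch functions are also required to have finite sup Im(ω)|f'(ω)|. *)

(* Defs.v *)
From Stdlib Require Import Reals.
From Coquelicot Require Import Coquelicot.

Open Scope R_scope.

(* Functions on the upper half plane are represented by total functions
   [C -> C] of which only the values on [upper_half_plane] matter; accordingly
   equality of such functions is [eq_on_U]. *)
Definition upper_half_plane (w : C) : Prop := 0 < Im w.

Definition eq_on_U (f g : C -> C) : Prop :=
  forall w : C, upper_half_plane w -> f w = g w.

(* [ex_derive] is here differentiability over the complex field. *)
Definition analytic_on_U (f : C -> C) : Prop :=
  forall w : C, upper_half_plane w -> ex_derive f w.

Definition bloch_density (f : C -> C) (w : C) : R := Im w * Cmod (C_derive f w).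

Definition bloch_sup (f : C -> C) : Rbar :=
  Lub_Rbar (fun x : R =>
    exists w : C, upper_half_plane w /\ x = bloch_density f w).

Definition bloch (f : C -> C) : Prop :=
  analytic_on_U f /\ Rbar_lt (bloch_sup f) p_infty.

(* Real-valued, hence meaningful only on [bloch], where the supremum is
   finite.  It is a seminorm vanishing exactly on the constants, and a norm on
   [little_bloch_i] below. *)
Definition bloch_norm (f : C -> C) : R := real (bloch_sup f).

(* The vanishing condition alone does not imply finiteness of the supremum
   ([fun w => w] satisfies it), so membership in the Bloch space, whose norm
   the little Bloch space carries, is required as well. The limit is uniform in
   the real part of [w]. *)
Definition little_bloch (f : C -> C) : Prop :=
  bloch f /\
  forall eps : R, 0 < eps ->
    exists delta : R, 0 < delta /\
      forall w : C, 0 < Im w < delta -> bloch_density f w < eps.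

Definition little_bloch_i (f : C -> C) : Prop := little_bloch f /\ f Ci = RtoC 0.

Definition translation (t : R) (g : C -> C) : C -> C :=
  fun w : C => g (w - RtoC t)%C.

(* [translation t] does not preserve the normalization [g Ci = RtoC 0].  Since
   [bloch_norm] does not see constants, [little_bloch_i] is the space of classes
   of [little_bloch] modulo constants, each class being represented by its
   member vanishing at [Ci]; this is the operator that [translation t] induces
   on classes. *)
Definition translation_i (t : R) (g : C -> C) : C -> C :=
  fun w : C => (translation t g w - translation t g Ci)%C.

(* [X] is a space of functions on the upper half plane and [N] its (semi)norm.
   Linearity and [icg_norm] together say that each [T t] is a linear isometry;
   it is onto by the group law. *)
Record strongly_continuous_isometry_group
    (X : (C -> C) -> Prop) (N : (C -> C) -> R)
    (T : R -> (C -> C) -> (C -> C)) : Prop := {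
  icg_stable : forall (t : R) (f : C -> C), X f -> X (T t f);
  icg_ext : forall (t : R) (f g : C -> C), X f -> X g ->
    eq_on_U f g -> eq_on_U (T t f) (T t g);
  icg_linear : forall (t : R) (a b : C) (f g : C -> C), X f -> X g ->
    eq_on_U (T t (fun w => (a * f w + b * g w)%C))
            (fun w => (a * T t f w + b * T t g w)%C);
  icg_zero : forall f : C -> C, X f -> eq_on_U (T 0 f) f;
  icg_add : forall (s t : R) (f : C -> C), X f ->
    eq_on_U (T (s + t) f) (T s (T t f));
  icg_norm : forall (t : R) (f : C -> C), X f -> N (T t f) = N f;
  icg_continuous : forall (f : C -> C) (t0 : R), X f ->
    filterlim (fun t : R => N (fun w => (T t f w - T t0 f w)%C))
              (locally t0) (locally 0)
}.

(* Main.v *)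
(* Translation commutes with differentiation and preserves [Im w], so only strong
   continuity needs an argument.  If [Im w] is small, both terms of
   [f'(w - t) - f'(w - t0)] are controlled by the little Bloch condition.
   Otherwise, [f] is Lipschitz at height at least [Im w / 2] since
   [|f'| <= M / Im], so [f(v - t) - f(v - t0)] is [O(|t - t0| / Im w)] on the disc
   of radius [Im w / 2] around [w], and the Cauchy estimate for the derivative
   gives [Im w |f'(w - t) - f'(w - t0)| = O(|t - t0| / Im w)].  The Cauchy estimate
   is obtained from Goursat's theorem on rectangles in logarithmic coordinates
   around [w]. *)
Require Import Defs.
From Stdlib Require Import Reals Lra ClassicalEpsilon.
From Coquelicot Require Import Coquelicot.

(** * Goursat's theorem for differentiable 1-forms on rectangles *)

(** The supremum of the left endpoints works, because every right endpoint bounds all left endpoints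
    from above. *)
Lemma nested_intervals (a b : nat -> R) :
  (forall n, a n <= a (S n)) -> (forall n, b (S n) <= b n) ->
  (forall n, a n <= b n) -> exists u : R, forall n, a n <= u <= b n.
Proof.
intros Ha Hb Hab.
assert (Ha' : forall n k, a n <= a (n + k)%nat).
{ intros n k; induction k as [|k IH].
  - rewrite Nat.add_0_r; lra.
  - rewrite Nat.add_succ_r; specialize (Ha (n + k)%nat); lra. }
assert (Hb' : forall n k, b (n + k)%nat <= b n).
{ intros n k; induction k as [|k IH].
  - rewrite Nat.add_0_r; lra.
  - rewrite Nat.add_succ_r; specialize (Hb (n + k)%nat); lra. }
assert (Hnm : forall n m, a n <= b m).
{ intros n m. specialize (Ha' n m). specialize (Hb' m n).
  specialize (Hab (n + m)%nat). rewrite Nat.add_comm in Hb'. lra. }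
destruct (completeness (fun x => exists n, x = a n)) as [u [Hub Hlub]].
- exists (b O). intros x [n ->]. apply Hnm.
- exists (a O); now exists O.
- exists u. intros n; split.
  + apply Hub; now exists n.
  + apply Hlub. intros x [m ->]. apply Hnm.
Qed.

Record rect := Rect { rl : R; rr : R; rb : R; rt : R }.

Definition proper (q : rect) : Prop := rl q <= rr q /\ rb q <= rt q.

Definition in_rect (q : rect) (u v : R) : Prop :=
  rl q <= u <= rr q /\ rb q <= v <= rt q.

(* Quartering a rectangle divides the square of the semiperimeter by exactly four,
   which makes it a substitute for the area that also bounds the diameter. *)
Definition semiperimeter (q : rect) : R := (rr q - rl q) + (rt q - rb q).

Definition quarter (i j : bool) (q : rect) : rect :=
  let mx := (rl q + rr q) / 2 in
  let my := (rb q + rt q) / 2 in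
  Rect (if i then mx else rl q) (if i then rr q else mx)
       (if j then my else rb q) (if j then rt q else my).

Lemma quarter_proper (i j : bool) (q : rect) : proper q -> proper (quarter i j q).
Proof. unfold proper; destruct i, j; simpl; lra. Qed.

Lemma in_rect_quarter (i j : bool) (q : rect) (u v : R) :
  proper q -> in_rect (quarter i j q) u v -> in_rect q u v.
Proof. unfold proper, in_rect; destruct i, j; simpl; lra. Qed.

Lemma semiperimeter_quarter (i j : bool) (q : rect) :
  semiperimeter (quarter i j q) = semiperimeter q / 2.
Proof. unfold semiperimeter; destruct i, j; simpl; field. Qed.

(** Compactness by contradiction: a bad rectangle has a bad quarter, and choosing one repeatedly
    gives nested bad rectangles whose sizes tend to zero. They share a point of [q], and the local
    hypothesis at that point makes the small ones good. *)
Lemma rect_bisection (good : rect -> Prop) (q : rect) :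
  proper q ->
  (forall q', proper q' -> (forall u v, in_rect q' u v -> in_rect q u v) ->
     (forall i j, good (quarter i j q')) -> good q') ->
  (forall u v, in_rect q u v -> exists delta, 0 < delta /\
     forall q', proper q' -> (forall u v, in_rect q' u v -> in_rect q u v) ->
       in_rect q' u v -> semiperimeter q' < delta -> good q') ->
  good q.
Proof.
intros Hq Hsplit Hloc.
apply NNPP; intros Hbad.
set (bad := fun q' => proper q' /\ (forall u v, in_rect q' u v -> in_rect q u v)
                      /\ ~ good q').
assert (Hnext : forall s : {q' | bad q'}, exists s' : {q' | bad q'},
          exists i j, proj1_sig s' = quarter i j (proj1_sig s)).
{ intros [q' [Hp [Hin Hg]]]; simpl.
  destruct (not_all_ex_not _ _ (fun H => Hg (Hsplit q' Hp Hin H))) as [i Hi].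
  destruct (not_all_ex_not _ _ Hi) as [j Hj].
  assert (Hb : bad (quarter i j q')).
  { repeat split; try apply quarter_proper; auto.
    all: apply (Hin u v), (in_rect_quarter i j); auto. }
  exists (exist _ _ Hb), i, j; reflexivity. }
pose (next := fun s => proj1_sig (constructive_indefinite_description _ (Hnext s))).
assert (Hstep : forall s, exists i j, proj1_sig (next s) = quarter i j (proj1_sig s)).
{ intros s. exact (proj2_sig (constructive_indefinite_description _ (Hnext s))). }
assert (H0 : bad q) by (split; [exact Hq | split; auto]).
pose (s := fun n => nat_rect (fun _ => {q' | bad q'}) (exist _ q H0) (fun _ => next) n).
pose (r := fun n => proj1_sig (s n)).
assert (Hr : forall n, exists i j, r (S n) = quarter i j (r n)).
{ intros n. apply (Hstep (s n)). }
assert (Hbadr : forall n, bad (r n)) by (intros n; apply (proj2_sig (s n))).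
clearbody r; clear s.
destruct (nested_intervals (fun n => rl (r n)) (fun n => rr (r n))) as [u Hu].
1,2: intros n; destruct (Hr n) as [[|] [j ->]]; destruct (Hbadr n) as [[? ?] _]; simpl; lra.
1: intros n; apply (Hbadr n).
destruct (nested_intervals (fun n => rb (r n)) (fun n => rt (r n))) as [v Hv].
1,2: intros n; destruct (Hr n) as [i [[|] ->]]; destruct (Hbadr n) as [[? ?] _]; simpl; lra.
1: intros n; apply (Hbadr n).
assert (Huv : forall n, in_rect (r n) u v) by (intros n; split; auto).
destruct (Hloc u v) as [delta [Hd Hgood]].
{ apply (Hbadr O), Huv. }
assert (Hsize : forall n, semiperimeter (r n) = semiperimeter (r O) * (/ 2) ^ n).
{ induction n as [|n IH]; simpl.
  - ring.
  - destruct (Hr n) as [i [j ->]]. rewrite semiperimeter_quarter, IH. field. }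
(* The [+ 1] keeps the denominator positive when [q] degenerates to a point. *)
destruct (pow_lt_1_zero (/ 2)) with (y := delta / (semiperimeter (r O) + 1)) as [N HN].
{ rewrite Rabs_pos_eq; lra. }
{ apply Rdiv_lt_0_compat; auto.
  destruct (Hbadr O) as [[? ?] _]; unfold semiperimeter; lra. }
specialize (HN N (le_n N)).
destruct (Hbadr N) as [Hp [Hin Hg]].
apply Hg, Hgood; auto.
rewrite Hsize.
assert (Hpow : 0 < (/ 2) ^ N) by (apply pow_lt; lra).
rewrite Rabs_pos_eq in HN by lra.
assert (Hs : 0 <= semiperimeter (r O)).
{ destruct (Hbadr O) as [[? ?] _]; unfold semiperimeter; lra. }
apply Rlt_div_r in HN; [nra | lra].
Qed.

(* The integral of [P dx + Q dy] around the boundary of [q], counterclockwise. *)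
Definition circulation (P Q : R -> R -> R) (q : rect) : R :=
  RInt (fun x => P x (rb q) - P x (rt q)) (rl q) (rr q) +
  RInt (fun y => Q (rr q) y - Q (rl q) y) (rb q) (rt q).

Lemma differentiable_pt_lim_is_derive_1 (P : R -> R -> R) (x y px py : R) :
  differentiable_pt_lim P x y px py -> is_derive (fun x => P x y) x px.
Proof.
intros H. replace px with (px * 1 + py * 0) by ring.
apply is_derive_Reals, (derivable_pt_lim_comp_2d P (fun t => t) (fun _ => y)); auto.
- apply derivable_pt_lim_id.
- apply derivable_pt_lim_const.
Qed.

Lemma differentiable_pt_lim_is_derive_2 (P : R -> R -> R) (x y px py : R) :
  differentiable_pt_lim P x y px py -> is_derive (fun y => P x y) y py.
Proof.
intros H. replace py with (px * 0 + py * 1) by ring.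
apply is_derive_Reals, (derivable_pt_lim_comp_2d P (fun _ => x) (fun t => t)); auto.
- apply derivable_pt_lim_const.
- apply derivable_pt_lim_id.
Qed.

(** Closedness is encoded by the shared [py]: it is both the [y]-derivative of [P] and the
    [x]-derivative of [Q]. Differentiability is pointwise, with no continuity of the partial
    derivatives, hence the argument by subdivision instead of Green's theorem. *)
Definition closed_form (P Q : R -> R -> R) (q : rect) : Prop :=
  forall u v, in_rect q u v -> exists px py qy,
    differentiable_pt_lim P u v px py /\ differentiable_pt_lim Q u v py qy.

Lemma closed_form_ex_RInt_1 (P Q : R -> R -> R) (q : rect) (a b y : R) :
  closed_form P Q q -> rl q <= a <= b -> b <= rr q -> rb q <= y <= rt q ->
  ex_RInt (fun x => P x y) a b.
Proof.
intros H Ha Hb Hy. apply (ex_RInt_continuous (fun x => P x y)).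
rewrite Rmin_left, Rmax_right by lra. intros x Hx.
destruct (H x y) as [px [py [qy [HP _]]]]; [split; lra|].
apply (ex_derive_continuous (fun x => P x y)). exists px.
apply (differentiable_pt_lim_is_derive_1 P x y _ _ HP).
Qed.

Lemma closed_form_ex_RInt_2 (P Q : R -> R -> R) (q : rect) (c d x : R) :
  closed_form P Q q -> rb q <= c <= d -> d <= rt q -> rl q <= x <= rr q ->
  ex_RInt (fun y => Q x y) c d.
Proof.
intros H Ha Hb Hy. apply (ex_RInt_continuous (fun y => Q x y)).
rewrite Rmin_left, Rmax_right by lra. intros y Hx.
destruct (H x y) as [px [py [qy [_ HQ]]]]; [split; lra|].
apply (ex_derive_continuous (fun y => Q x y)). exists qy.
apply (differentiable_pt_lim_is_derive_2 Q x y _ _ HQ).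
Qed.

(** Each inner edge is run through twice in opposite directions and cancels; the outer edges
    recombine by Chasles. *)
Lemma circulation_split (P Q : R -> R -> R) (q : rect) :
  proper q -> closed_form P Q q ->
  circulation P Q q =
    circulation P Q (quarter false false q) + circulation P Q (quarter false true q) +
    circulation P Q (quarter true false q) + circulation P Q (quarter true true q).
Proof.
intros [Hx Hy] H. unfold circulation; simpl.
set (mx := (rl q + rr q) / 2). set (my := (rb q + rt q) / 2).
assert (Hmx : rl q <= mx <= rr q) by (unfold mx; lra).
assert (Hmy : rb q <= my <= rt q) by (unfold my; lra).
assert (E1 : forall a b y, rl q <= a <= b -> b <= rr q -> rb q <= y <= rt q ->
             ex_RInt (fun x => P x y) a b).
{ intros a b y; intros; eapply closed_form_ex_RInt_1; eauto. }
assert (E2 : forall c d x, rb q <= c <= d -> d <= rt q -> rl q <= x <= rr q ->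
             ex_RInt (fun y => Q x y) c d).
{ intros c d x; intros; eapply closed_form_ex_RInt_2; eauto. }
assert (M1 : forall a b y y', rl q <= a <= b -> b <= rr q -> rb q <= y <= rt q ->
   rb q <= y' <= rt q -> RInt (fun x => P x y - P x y') a b =
   RInt (fun x => P x y) a b - RInt (fun x => P x y') a b).
{ intros a b y y' H1 H2 H3 H4. apply (RInt_minus (fun x => P x y) (fun x => P x y')); auto. }
assert (M2 : forall c d x x', rb q <= c <= d -> d <= rt q -> rl q <= x <= rr q ->
   rl q <= x' <= rr q -> RInt (fun y => Q x y - Q x' y) c d =
   RInt (fun y => Q x y) c d - RInt (fun y => Q x' y) c d).
{ intros c d x x' H1 H2 H3 H4. apply (RInt_minus (fun y => Q x y) (fun y => Q x' y)); auto. }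
assert (C1 : forall y, rb q <= y <= rt q -> RInt (fun x => P x y) (rl q) (rr q) =
   RInt (fun x => P x y) (rl q) mx + RInt (fun x => P x y) mx (rr q)).
{ intros y Hy'. symmetry. apply (RInt_Chasles (fun x => P x y)); apply E1; lra. }
assert (C2 : forall x, rl q <= x <= rr q -> RInt (fun y => Q x y) (rb q) (rt q) =
   RInt (fun y => Q x y) (rb q) my + RInt (fun y => Q x y) my (rt q)).
{ intros x Hx'. symmetry. apply (RInt_Chasles (fun y => Q x y)); apply E2; lra. }
rewrite !M1, !M2 by lra. rewrite !C1, !C2 by lra. ring.
Qed.

Lemma RInt_near_const (g : R -> R) (a b k e : R) :
  a <= b -> ex_RInt g a b -> (forall t, a <= t <= b -> Rabs (g t - k) <= e) ->
  Rabs (RInt g a b - (b - a) * k) <= (b - a) * e.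
Proof.
intros Hab Hg He.
replace (RInt g a b - (b - a) * k) with (RInt (fun t => g t - k) a b).
- apply abs_RInt_le_const; auto.
  apply (ex_RInt_minus g (fun _ => k)); auto. apply ex_RInt_const.
- rewrite (RInt_minus g (fun _ => k)); auto; [|apply ex_RInt_const].
  rewrite RInt_const. reflexivity.
Qed.

(** Near [(u, v)] both coefficients equal their first-order expansions up to [eps / 4] times the
    semiperimeter. The affine part of a closed form has zero circulation, so only the error,
    integrated over sides of total length at most the semiperimeter, remains. *)
Lemma goursat_local (P Q : R -> R -> R) (q : rect) (u v eps : R) :
  closed_form P Q q -> in_rect q u v -> 0 < eps ->
  exists delta, 0 < delta /\
    forall q', proper q' -> (forall u v, in_rect q' u v -> in_rect q u v) ->
      in_rect q' u v -> semiperimeter q' < delta ->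
      Rabs (circulation P Q q') <= eps * (semiperimeter q' * semiperimeter q').
Proof.
intros H Huv Heps.
destruct (H u v Huv) as [px [py [qy [HP HQ]]]].
assert (He4 : 0 < eps / 4) by lra.
destruct (HP (mkposreal _ He4)) as [d1 H1].
destruct (HQ (mkposreal _ He4)) as [d2 H2].
simpl in H1, H2.
exists (Rmin d1 d2); split.
{ apply Rmin_case; apply cond_pos. }
intros q' [Hx Hy] Hin [Hu Hv] Hs.
assert (Hs1 : semiperimeter q' < d1) by (eapply Rlt_le_trans; [exact Hs | apply Rmin_l]).
assert (Hs2 : semiperimeter q' < d2) by (eapply Rlt_le_trans; [exact Hs | apply Rmin_r]).
set (p := semiperimeter q') in *.
assert (Hp : p = (rr q' - rl q') + (rt q' - rb q')) by reflexivity.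
clearbody p. clear HP HQ Hs.
assert (B : forall x y, in_rect q' x y -> Rabs (x - u) <= p /\ Rabs (y - v) <= p).
{ intros x y [? ?]; split; apply Rabs_le; lra. }
assert (P1 : forall x y, in_rect q' x y ->
  Rabs (P x y - P u v - (px * (x - u) + py * (y - v))) <= eps / 4 * p).
{ intros x y Hxy. destruct (B x y Hxy) as [B1 B2].
  eapply Rle_trans; [apply H1; lra|].
  apply Rmult_le_compat_l; [lra|]. now apply Rmax_lub. }
assert (Q1 : forall x y, in_rect q' x y ->
  Rabs (Q x y - Q u v - (py * (x - u) + qy * (y - v))) <= eps / 4 * p).
{ intros x y Hxy. destruct (B x y Hxy) as [B1 B2].
  eapply Rle_trans; [apply H2; lra|].
  apply Rmult_le_compat_l; [lra|]. now apply Rmax_lub. }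
assert (H' : closed_form P Q q') by (intros x y Hxy; apply H, Hin, Hxy).
(* On two opposite sides the affine expansions differ by a constant, and the two errors of
   [eps / 4 * p] add up to [eps / 2 * p]. *)
assert (I1 := RInt_near_const (fun x => P x (rb q') - P x (rt q')) (rl q') (rr q')
  (py * (rb q' - rt q')) (eps / 2 * p) Hx).
assert (I2 := RInt_near_const (fun y => Q (rr q') y - Q (rl q') y) (rb q') (rt q')
  (py * (rr q' - rl q')) (eps / 2 * p) Hy).
unfold circulation.
set (R1 := RInt _ (rl q') (rr q')) in *. set (R2 := RInt _ (rb q') (rt q')) in *.
assert (J1 : Rabs (R1 - (rr q' - rl q') * (py * (rb q' - rt q')))
              <= (rr q' - rl q') * (eps / 2 * p)).
{ apply I1.
  - apply (ex_RInt_minus (fun x => P x (rb q')) (fun x => P x (rt q')));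
      apply (closed_form_ex_RInt_1 P Q q'); auto; lra.
  - intros x Hx'.
    assert (A1 := P1 x (rb q')). assert (A2 := P1 x (rt q')).
    unfold in_rect in A1, A2.
    assert (A1' := A1 ltac:(lra)). assert (A2' := A2 ltac:(lra)).
    apply Rabs_le_between in A1'. apply Rabs_le_between in A2'.
    apply Rabs_le. lra. }
assert (J2 : Rabs (R2 - (rt q' - rb q') * (py * (rr q' - rl q')))
              <= (rt q' - rb q') * (eps / 2 * p)).
{ apply I2.
  - apply (ex_RInt_minus (fun y => Q (rr q') y) (fun y => Q (rl q') y));
      apply (closed_form_ex_RInt_2 P Q q'); auto; lra.
  - intros y Hy'.
    assert (A1 := Q1 (rr q') y). assert (A2 := Q1 (rl q') y).
    unfold in_rect in A1, A2.
    assert (A1' := A1 ltac:(lra)). assert (A2' := A2 ltac:(lra)).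
    apply Rabs_le_between in A1'. apply Rabs_le_between in A2'.
    apply Rabs_le. lra. }
clearbody R1 R2.
apply Rabs_le_between in J1. apply Rabs_le_between in J2.
assert (Hpp : (rr q' - rl q') * (eps / 2 * p) + (rt q' - rb q') * (eps / 2 * p)
              = eps / 2 * (p * p)) by (rewrite Hp; ring).
assert (0 <= eps * (p * p)) by (apply Rmult_le_pos; [lra | apply Rle_0_sqr]).
(* Closedness enters here: the same [py] occurs in both main terms, which therefore cancel. *)
assert (Hz : (rr q' - rl q') * (py * (rb q' - rt q')) +
             (rt q' - rb q') * (py * (rr q' - rl q')) = 0) by ring.
apply Rabs_le. lra.
Qed.

(** The bound by [eps] times the squared semiperimeter passes from the four quarters to the whole,
    since each quarter carries a fourth of the square. It holds locally for every [eps], hence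
    globally, which forces the circulation to vanish. *)
Lemma goursat (P Q : R -> R -> R) (q : rect) :
  proper q -> closed_form P Q q -> circulation P Q q = 0.
Proof.
intros Hq H.
assert (Hle : forall eps, 0 < eps ->
  Rabs (circulation P Q q) <= eps * (semiperimeter q * semiperimeter q)).
{ intros eps Heps.
  apply (rect_bisection (fun q => Rabs (circulation P Q q)
           <= eps * (semiperimeter q * semiperimeter q))); auto.
  - intros q' Hp Hin Hg.
    rewrite circulation_split; auto; [|intros u v Huv; apply H, Hin, Huv].
    assert (A : forall i j, Rabs (circulation P Q (quarter i j q')) <=
       eps * (semiperimeter q' * semiperimeter q') / 4).
    { intros i j. eapply Rle_trans; [apply Hg|]. rewrite semiperimeter_quarter. right; field. }
    assert (A1 := A false false). assert (A2 := A false true).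
    assert (A3 := A true false). assert (A4 := A true true).
    apply Rabs_le_between in A1. apply Rabs_le_between in A2.
    apply Rabs_le_between in A3. apply Rabs_le_between in A4.
    apply Rabs_le. lra.
  - intros u v Huv. now apply (goursat_local P Q q). }
apply NNPP; intros Hne.
assert (Hpos := Rabs_pos_lt _ Hne).
set (k := semiperimeter q * semiperimeter q) in *.
assert (Hk : 0 <= k) by apply Rle_0_sqr.
(* With this [eps] the bound falls strictly below a nonzero circulation; [k + 1] also covers
   [k = 0]. *)
assert (Hc := Hle (Rabs (circulation P Q q) / (2 * (k + 1)))).
assert (0 < Rabs (circulation P Q q) / (2 * (k + 1))) by (apply Rdiv_lt_0_compat; lra).
specialize (Hc H0).
replace (Rabs (circulation P Q q) / (2 * (k + 1)) * k)
  with (Rabs (circulation P Q q) * k / (2 * (k + 1))) in Hc by (field; lra).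
apply Rle_div_r in Hc; [nra | lra].
Qed.

(** * Complex derivatives and the exponential *)

Lemma is_derive_C_iff (f : C -> C) (z l : C) :
  is_derive f z l <->
  (forall eps, 0 < eps -> exists delta, 0 < delta /\ forall w : C,
     Cmod (w - z) < delta ->
     Cmod (f w - f z - (w - z) * l)%C <= eps * Cmod (w - z)).
Proof.
split.
- intros [_ H] eps Heps.
  destruct (H z (fun P HP => HP) (mkposreal _ Heps)) as [d Hd].
  exists d; split; [apply cond_pos|]. intros w Hw. exact (Hd w Hw).
- intros H. split.
  + apply (is_linear_scal_l (K := C_AbsRing) (V := C_NormedModule) l).
  + intros x Hx. apply (is_filter_lim_locally_unique (K := C_AbsRing)
      (V := AbsRing_NormedModule C_AbsRing)) in Hx. subst x.
    intros [eps Heps]. destruct (H eps Heps) as [d [Hd H']].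
    exists (mkposreal d Hd). intros w Hw. exact (H' w Hw).
Qed.

Lemma Cmod_le_Rabs (z : C) : Cmod z <= Rabs (Re z) + Rabs (Im z).
Proof.
unfold Cmod. rewrite <- (sqrt_Rsqr (Rabs (Re z) + Rabs (Im z))).
- apply sqrt_le_1_alt. unfold Rsqr.
  change (fst z) with (Re z). change (snd z) with (Im z).
  assert (H1 := pow2_abs (Re z)). assert (H2 := pow2_abs (Im z)).
  assert (0 <= Rabs (Re z)) by apply Rabs_pos. assert (0 <= Rabs (Im z)) by apply Rabs_pos.
  nra.
- assert (0 <= Rabs (Re z)) by apply Rabs_pos. assert (0 <= Rabs (Im z)) by apply Rabs_pos. lra.
Qed.

Lemma Rabs_Im_le_Cmod (z : C) : Rabs (Im z) <= Cmod z.
Proof. eapply Rle_trans; [apply Rmax_r | apply Rmax_Cmod]. Qed.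

(** The real and imaginary parts of the complex first-order remainder are the remainders of the two
    real components. The max norm and [Cmod] differ by a factor of at most 2, hence [eps / 2] in
    both directions. *)
Lemma cauchy_riemann (f : C -> C) (x y : R) (l : C) :
  is_derive f (x, y) l <->
  differentiable_pt_lim (fun u v => Re (f (u, v))) x y (Re l) (- Im l) /\
  differentiable_pt_lim (fun u v => Im (f (u, v))) x y (Im l) (Re l).
Proof.
rewrite is_derive_C_iff.
assert (HRe : forall u v, Re (f (u, v) - f (x, y) - ((u, v) - (x, y)) * l)%C =
  Re (f (u, v)) - Re (f (x, y)) - (Re l * (u - x) + - Im l * (v - y))).
{ intros; unfold Re, Im; simpl; unfold Re, Im; ring. }
assert (HIm : forall u v, Im (f (u, v) - f (x, y) - ((u, v) - (x, y)) * l)%C =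
  Im (f (u, v)) - Im (f (x, y)) - (Im l * (u - x) + Re l * (v - y))).
{ intros; unfold Re, Im; simpl; unfold Re, Im; ring. }
assert (Hmax : forall u v, Rmax (Rabs (u - x)) (Rabs (v - y)) <= Cmod ((u, v) - (x, y))%C).
{ intros u v. exact (Rmax_Cmod (u - x, v - y)). }
assert (Hmod : forall u v, Cmod ((u, v) - (x, y))%C <= Rabs (u - x) + Rabs (v - y)).
{ intros u v. exact (Cmod_le_Rabs (u - x, v - y)). }
split.
- intros H.
  assert (A : forall eps : posreal, locally_2d (fun u v =>
     Cmod (f (u, v) - f (x, y) - ((u, v) - (x, y)) * l)%C
       <= eps * Rmax (Rabs (u - x)) (Rabs (v - y))) x y).
  { intros eps. destruct (H (eps / 2)) as [d [Hd H']].
    { assert (B := cond_pos eps); lra. }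
    assert (Hd2 : 0 < d / 2) by lra.
    exists (mkposreal _ Hd2); simpl. intros u v Hu Hv.
    eapply Rle_trans; [apply H'|].
    - specialize (Hmod u v); lra.
    - specialize (Hmod u v).
      assert (B1 := Rmax_l (Rabs (u - x)) (Rabs (v - y))).
      assert (B2 := Rmax_r (Rabs (u - x)) (Rabs (v - y))).
      assert (B := cond_pos eps). nra. }
  split; intros eps; destruct (A eps) as [d Hd]; exists d; intros u v Hu Hv.
  + rewrite <- HRe. eapply Rle_trans; [apply re_le_Cmod | apply Hd; auto].
  + rewrite <- HIm. eapply Rle_trans; [apply Rabs_Im_le_Cmod | apply Hd; auto].
- intros [H1 H2] eps Heps.
  assert (He : 0 < eps / 2) by lra.
  destruct (H1 (mkposreal _ He)) as [d1 D1]. destruct (H2 (mkposreal _ He)) as [d2 D2].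
  exists (Rmin d1 d2); split; [apply Rmin_case; apply cond_pos|].
  intros [u v] Hw. specialize (Hmax u v).
  assert (B1 := Rmax_l (Rabs (u - x)) (Rabs (v - y))).
  assert (B2 := Rmax_r (Rabs (u - x)) (Rabs (v - y))).
  assert (M1 := Rmin_l d1 d2). assert (M2 := Rmin_r d1 d2).
  eapply Rle_trans; [apply Cmod_le_Rabs|].
  rewrite HRe, HIm.
  specialize (D1 u v ltac:(lra) ltac:(lra)). specialize (D2 u v ltac:(lra) ltac:(lra)).
  simpl in D1, D2.
  assert (eps / 2 * Rmax (Rabs (u - x)) (Rabs (v - y)) <= eps / 2 * Cmod ((u, v) - (x, y))%C).
  { apply Rmult_le_compat_l; lra. }
  lra.
Qed.

Definition Cexp (z : C) : C := (exp (Re z) * cos (Im z), exp (Re z) * sin (Im z)).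

Lemma Cmod_Cexp (z : C) : Cmod (Cexp z) = exp (Re z).
Proof.
unfold Cmod, Cexp; simpl.
replace (_ + _) with ((exp (Re z))²).
- apply sqrt_Rsqr, Rlt_le, exp_pos.
- assert (H := sin2_cos2 (Im z)). unfold Rsqr in *.
  transitivity (exp (Re z) * exp (Re z) * (sin (Im z) * sin (Im z) + cos (Im z) * cos (Im z))).
  + rewrite H; ring.
  + ring.
Qed.

Lemma Cexp_neq_0 (z : C) : Cexp z <> 0%C.
Proof. apply Cmod_gt_0. rewrite Cmod_Cexp. apply exp_pos. Qed.

Lemma Cexp_opp (z : C) : Cexp (- z) = (/ Cexp z)%C.
Proof.
assert (H : (Cexp (- z) * Cexp z)%C = 1%C).
{ unfold Cexp; simpl. rewrite exp_Ropp, cos_neg, sin_neg.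
  assert (Hs := sin2_cos2 (Im z)). unfold Rsqr in *.
  assert (He := exp_pos (Re z)).
  unfold Re, Im in *. apply injective_projections; simpl.
  - rewrite <- Hs. field. lra.
  - field. lra. }
rewrite <- (Cmult_1_l (/ Cexp z)), <- H. field. apply Cexp_neq_0.
Qed.

Lemma differentiable_pt_lim_mult (x y : R) : differentiable_pt_lim Rmult x y y x.
Proof.
intros eps. exists eps. intros u v Hu Hv.
replace (u * v - x * y - (y * (u - x) + x * (v - y))) with ((u - x) * (v - y)) by ring.
rewrite Rabs_mult. apply Rmult_le_compat; try apply Rabs_pos; [lra | apply Rmax_r].
Qed.

Lemma differentiable_pt_lim_prod (g h : R -> R) (x y g' h' : R) :
  is_derive g x g' -> is_derive h y h' ->
  differentiable_pt_lim (fun u v => g u * h v) x y (h y * g') (g x * h').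
Proof.
intros Hg%is_derive_Reals Hh%is_derive_Reals.
assert (H1 : differentiable_pt_lim (fun u v => g u) x y g' 0).
{ now apply differentiable_pt_lim_proj1_0. }
assert (H2 : differentiable_pt_lim (fun u v => h v) x y 0 h').
{ intros eps. destruct (differentiable_pt_lim_proj1_0 h y x h' Hh eps) as [d Hd].
  exists d. intros u v Hu Hv. specialize (Hd v u Hv Hu). simpl in Hd.
  rewrite Rmax_comm.
  now replace (0 * (u - x) + h' * (v - y)) with (h' * (v - y) + 0 * (u - x)) by ring. }
assert (H := differentiable_pt_lim_comp Rmult (fun u v => g u) (fun u v => h v) x y
  _ _ _ _ _ _ (differentiable_pt_lim_mult (g x) (h y)) H1 H2).
cbv beta in H.
replace (h y * g') with (h y * g' + g x * 0) by ring.
replace (g x * h') with (h y * 0 + g x * h') by ring.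
exact H.
Qed.

Lemma is_derive_Cexp (z : C) : is_derive Cexp z (Cexp z).
Proof.
destruct z as [x y]. apply cauchy_riemann. simpl. split.
- replace (exp x * cos y) with (cos y * exp x) by ring.
  replace (- (exp x * sin y)) with (exp x * (- sin y)) by ring.
  apply differentiable_pt_lim_prod; [apply is_derive_exp | apply is_derive_cos].
- replace (exp x * sin y) with (sin y * exp x) by ring.
  apply differentiable_pt_lim_prod; [apply is_derive_exp | apply is_derive_sin].
Qed.

(** * Cauchy estimate *)

(* Coquelicot equips [C] with two normed module structures over itself; their
   topologies are defined by different balls. *)
Lemma is_derive_C_AbsRing (f : C -> C) (z l : C) :
  @is_derive C_AbsRing C_NormedModule f z l <->
  @is_derive C_AbsRing (AbsRing_NormedModule C_AbsRing) f z l.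
Proof. split; intros [[H1 H2 H3] H]; split; [split| |split|]; assumption. Qed.

Lemma is_derive_C_translation (f : C -> C) (w c l : C) :
  is_derive f (w + c)%C l -> is_derive (fun v => f (v + c)%C) w l.
Proof.
rewrite !is_derive_C_iff. intros H eps Heps.
destruct (H eps Heps) as [d [Hd H']].
exists d; split; auto. intros v Hv.
replace (v - w)%C with ((v + c) - (w + c))%C in * by ring. auto.
Qed.

(** With [w = z + Cexp v], the factor [Cexp (- v)] is [1 / (w - z)]: this is the difference quotient
    of [h] at [z] in the logarithmic coordinate [v]. *)
Lemma ex_derive_difference_quotient (h : C -> C) (z u : C) :
  ex_derive h (z + Cexp u)%C ->
  ex_derive (fun v => (h (z + Cexp v) - h z) * Cexp (- v))%C u.
Proof.
intros [l Hl].
assert (D1 : is_derive (fun v => h (z + Cexp v)%C) u (Cexp u * l)%C).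
{ apply (is_derive_comp (K := C_AbsRing) (V := C_NormedModule) (fun v => h (z + v)%C) Cexp).
  - rewrite Cplus_comm in Hl. apply is_derive_C_translation in Hl.
    eapply is_derive_ext; [|exact Hl]. intros v. simpl. now rewrite Cplus_comm.
  - apply is_derive_C_AbsRing, is_derive_Cexp. }
assert (D2 : is_derive (fun v => h (z + Cexp v) - h z)%C u (Cexp u * l - 0)%C).
{ apply (is_derive_minus (K := C_AbsRing) (V := C_NormedModule)
    (fun v => h (z + Cexp v)%C) (fun _ => h z)); auto.
  apply (is_derive_const (K := C_AbsRing) (V := C_NormedModule)). }
assert (D3 : is_derive (fun v => Cexp (- v)) u (- (1) * Cexp (- u))%C).
{ apply (is_derive_comp (K := C_AbsRing) (V := C_NormedModule) Cexp (fun v => - v)%C).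
  - apply is_derive_Cexp.
  - apply (is_derive_opp (K := C_AbsRing) (V := AbsRing_NormedModule C_AbsRing) (fun v => v)).
    apply (is_derive_id (K := C_AbsRing)). }
eexists.
apply is_derive_C_AbsRing in D2, D3. apply is_derive_C_AbsRing.
apply (is_derive_mult (K := C_AbsRing) (fun v => h (z + Cexp v) - h z)%C
  (fun v => Cexp (- v)) u _ _ D2 D3 Cmult_comm).
Qed.

Lemma Cexp_periodic (x : R) : Cexp (x, 0) = Cexp (x, 2 * PI).
Proof. unfold Cexp; simpl. now rewrite sin_2PI, sin_0, cos_2PI, cos_0. Qed.

Lemma Cexp_opp_periodic (x : R) : Cexp (- (x, 0)) = Cexp (- (x, 2 * PI)).
Proof. now rewrite !Cexp_opp, Cexp_periodic. Qed.

(* [Re] of the integral of [(h w - h z) / (w - z)] with respect to the argument of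
   [w - z] does not depend on the radius: Goursat on the rectangle
   [[a, b] x [0, 2 PI]] in the variable [log (w - z)], where the horizontal sides
   cancel by periodicity. *)
Lemma circle_mean_invariant (h : C -> C) (z : C) (a b : R) :
  a <= b -> (forall w, Cmod (w - z) <= exp b -> ex_derive h w) ->
  let g := fun x y => Re ((h (z + Cexp (x, y)) - h z) * Cexp (- (x, y)))%C in
  ex_RInt (fun y => g b y - g a y) 0 (2 * PI) /\
  RInt (fun y => g b y - g a y) 0 (2 * PI) = 0.
Proof.
intros Hab Hh g.
assert (HPI := PI_RGT_0).
set (G := fun v => ((h (z + Cexp v) - h z) * Cexp (- v))%C).
set (q := Rect a b 0 (2 * PI)).
(* This form is the imaginary part of [G dv] with [dv = dx + i dy]; it is closed by the
   Cauchy-Riemann equations, and its vertical sides carry [Re G]. *)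
assert (Hcl : closed_form (fun x y => Im (G (x, y))) (fun x y => Re (G (x, y))) q).
{ intros u v [Hu Hv]; simpl in Hu, Hv.
  destruct (ex_derive_difference_quotient h z (u, v)) as [l Hl].
  - apply Hh. replace (z + Cexp (u, v) - z)%C with (Cexp (u, v)) by ring.
    rewrite Cmod_Cexp; simpl. destruct (Rle_lt_or_eq_dec _ _ (proj2 Hu)) as [H| ->].
    + now apply Rlt_le, exp_increasing.
    + lra.
  - apply cauchy_riemann in Hl. exists (Im l), (Re l), (- Im l). split; apply Hl. }
split.
- apply (ex_RInt_minus (fun y => g b y) (fun y => g a y));
    apply (closed_form_ex_RInt_2 _ _ q _ _ _ Hcl); simpl; lra.
- assert (Hg := goursat _ _ q ltac:(split; simpl; lra) Hcl).
  unfold circulation in Hg; simpl in Hg.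
  rewrite (RInt_ext (fun x => Im (G (x, 0)) - Im (G (x, 2 * PI))) (fun _ => 0)) in Hg.
  + rewrite RInt_const in Hg. 
    change (scal (b - a) 0) with ((b - a) * 0) in Hg.
    rewrite Rmult_0_r, Rplus_0_l in Hg. exact Hg.
  + intros x _. unfold G. rewrite Cexp_periodic, Cexp_opp_periodic. exact (Rminus_diag_eq _ _ eq_refl).
Qed.

(* Compares the circle of radius [r] with one so small that the integrand is
   within [eps] of [Re l]. *)
Lemma cauchy_estimate_Re (h : C -> C) (z l : C) (r K : R) :
  0 < r -> (forall w, Cmod (w - z) <= r -> ex_derive h w) ->
  (forall w, Cmod (w - z) <= r -> Cmod (h w - h z) <= K) ->
  is_derive h z l -> Rabs (Re l) <= K / r.
Proof.
intros Hr Hh HK Hl.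
apply le_epsilon. intros eps Heps.
destruct (proj1 (is_derive_C_iff h z l) Hl eps Heps) as [d [Hd Hquot]].
set (b := ln r).
(* The inner radius is at most [r], so that [a <= b], and strictly below [d], where the difference
   quotient is close to [l]. *)
set (a := ln (Rmin r (d / 2))).
assert (Hm : 0 < Rmin r (d / 2)) by (apply Rmin_case; lra).
assert (Hab : a <= b) by (apply ln_le; [exact Hm | apply Rmin_l]).
assert (Eb : exp b = r) by (apply exp_ln; lra).
assert (Ea : exp a < d).
{ unfold a; rewrite exp_ln by exact Hm. assert (H := Rmin_r r (d / 2)). lra. }
destruct (circle_mean_invariant h z a b Hab) as [Hex H0]; [now rewrite Eb|].
set (g := fun x y => Re ((h (z + Cexp (x, y)) - h z) * Cexp (- (x, y)))%C) in *.
assert (Hgb : forall y, Rabs (g b y) <= K / r).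
{ intros y. eapply Rle_trans; [apply re_le_Cmod|].
  rewrite Cmod_mult, Cmod_Cexp.
  change (Re (- (b, y))%C) with (- b). rewrite exp_Ropp, Eb.
  apply Rmult_le_compat_r; [left; now apply Rinv_0_lt_compat|].
  apply HK. replace (z + Cexp (b, y) - z)%C with (Cexp (b, y)) by ring.
  rewrite Cmod_Cexp; simpl. lra. }
assert (Hga : forall y, Rabs (g a y - Re l) <= eps).
{ intros y. set (E := Cexp (a, y)).
  assert (HE : Cmod E = exp a) by apply Cmod_Cexp.
  assert (HE0 : E <> 0%C) by apply Cexp_neq_0.
  assert (H := Hquot (z + E)%C).
  replace (z + E - z)%C with E in H by ring.
  rewrite HE in H. specialize (H Ea).
  replace (g a y - Re l) with (Re ((h (z + E) - h z - E * l) * / E)%C).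
  - eapply Rle_trans; [apply re_le_Cmod|].
    rewrite Cmod_mult, Cmod_inv, HE by exact HE0.
    apply Rle_div_l in H; [exact H | apply exp_pos].
  - transitivity (Re ((h (z + E) - h z) * Cexp (- (a, y)) - l)%C).
    + f_equal. rewrite Cexp_opp. fold E. field. exact HE0.
    + reflexivity. }
assert (HPI := PI_RGT_0).
(* The integrand has integral zero but stays within [K / r + eps] of [- Re l], so
   [2 * PI * Rabs (Re l)] is at most [2 * PI * (K / r + eps)]. *)
assert (Hnear := RInt_near_const (fun y => g b y - g a y) 0 (2 * PI) (- Re l) (K / r + eps)
  ltac:(lra) Hex).
change (RInt (fun y => g b y - g a y) 0 (2 * PI) = 0) in H0.
rewrite H0 in Hnear.
replace (0 - (2 * PI - 0) * - Re l) with (2 * PI * Re l) in Hnear by ring.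
rewrite Rabs_mult, (Rabs_pos_eq (2 * PI)), Rminus_0_r in Hnear by lra.
apply (Rmult_le_reg_l (2 * PI)); [lra|].
apply Hnear. intros y _.
assert (A1 := Hgb y). assert (A2 := Hga y).
apply Rabs_le_between in A1. apply Rabs_le_between in A2.
apply Rabs_le. lra.
Qed.

(** Multiplication by [- Ci] turns the imaginary part of the derivative into a real part; adding the
    two estimates costs the factor 2. *)
Lemma cauchy_estimate (h : C -> C) (z l : C) (r K : R) :
  0 < r -> (forall w, Cmod (w - z) <= r -> ex_derive h w) ->
  (forall w, Cmod (w - z) <= r -> Cmod (h w - h z) <= K) ->
  is_derive h z l -> Cmod l <= 2 * K / r.
Proof.
intros Hr Hh HK Hl.
assert (Hrot : forall w m, is_derive h w m -> is_derive (fun v => - Ci * h v)%C w (- Ci * m)%C).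
{ intros w m. rewrite !is_derive_C_iff. intros Hm eps Heps.
  destruct (Hm eps Heps) as [d [Hd H]]. exists d; split; auto. intros v Hv.
  replace (- Ci * h v - - Ci * h w - (v - w) * (- Ci * m))%C
    with (- Ci * (h v - h w - (v - w) * m))%C by ring.
  rewrite Cmod_mult, Cmod_opp, Cmod_Ci, Rmult_1_l. auto. }
eapply Rle_trans; [apply Cmod_le_Rabs|].
replace (2 * K / r) with (K / r + K / r) by (field; lra).
apply Rplus_le_compat.
- eapply cauchy_estimate_Re; eauto.
- replace (Im l) with (Re (- Ci * l)%C) by (destruct l; unfold Re, Im; simpl; ring).
  apply (cauchy_estimate_Re (fun v => - Ci * h v)%C z); auto.
  + intros w Hw. destruct (Hh w Hw) as [m Hm]. exists (- Ci * m)%C. now apply Hrot.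
  + intros w Hw. replace (- Ci * h w - - Ci * h z)%C with (- Ci * (h w - h z))%C by ring.
    rewrite Cmod_mult, Cmod_opp, Cmod_Ci, Rmult_1_l. auto.
Qed.

(** * Translations on the Bloch space *)

Lemma is_derive_horizontal (f : C -> C) (x y : R) (l : C) :
  is_derive f (x, y) l ->
  is_derive (fun u => Re (f (u, y))) x (Re l) /\
  is_derive (fun u => Im (f (u, y))) x (Im l).
Proof.
intros [H1 H2]%cauchy_riemann. split.
- exact (differentiable_pt_lim_is_derive_1 (fun u v => Re (f (u, v))) _ _ _ _ H1).
- exact (differentiable_pt_lim_is_derive_1 (fun u v => Im (f (u, v))) _ _ _ _ H2).
Qed.

(** The real mean value inequality is applied to the real and imaginary parts separately, whence the
    factor 2. *)
Lemma Cmod_horizontal_increment (f : C -> C) (y x1 x2 B : R) :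
  (forall x, ex_derive f (x, y) /\ Cmod (C_derive f (x, y)) <= B) ->
  Cmod (f (x2, y) - f (x1, y))%C <= 2 * B * Rabs (x2 - x1).
Proof.
intros H.
assert (HD : forall x, is_derive f (x, y) (C_derive f (x, y))).
{ intros x. apply C_derive_correct; [exact (RtoC 0) | apply H]. }
eapply Rle_trans; [apply Cmod_le_Rabs|].
replace (2 * B * Rabs (x2 - x1)) with (B * Rabs (x2 - x1) + B * Rabs (x2 - x1)) by ring.
apply Rplus_le_compat.
- apply (bounded_variation (fun u => Re (f (u, y))) (fun u => Re (C_derive f (u, y)))).
  intros x _; split; [apply is_derive_horizontal, HD|].
  eapply Rle_trans; [apply re_le_Cmod | apply H].
- apply (bounded_variation (fun u => Im (f (u, y))) (fun u => Im (C_derive f (u, y)))).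
  intros x _; split; [apply is_derive_horizontal, HD|].
  eapply Rle_trans; [apply Rabs_Im_le_Cmod | apply H].
Qed.

Lemma upper_half_plane_translation (w : C) (t : R) :
  upper_half_plane w -> upper_half_plane (w - RtoC t)%C.
Proof. unfold upper_half_plane; destruct w; simpl; lra. Qed.

Lemma Im_translation (w : C) (t : R) : Im (w - RtoC t)%C = Im w.
Proof. destruct w; simpl; ring. Qed.

Lemma is_derive_translation (f : C -> C) (t : R) (w : C) :
  analytic_on_U f -> upper_half_plane w ->
  is_derive (translation t f) w (C_derive f (w - RtoC t)%C).
Proof.
intros Hf Hw. apply (is_derive_C_translation f w (- RtoC t)%C), C_derive_correct.
- exact (RtoC 0).
- now apply Hf, upper_half_plane_translation.
Qed.

Lemma bloch_density_bounded (f : C -> C) :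
  bloch f -> exists M, 0 <= M /\ forall w, upper_half_plane w -> bloch_density f w <= M.
Proof.
intros [_ Hsup].
destruct (Lub_Rbar_correct (fun x => exists w, upper_half_plane w /\ x = bloch_density f w))
  as [Hub _]. fold (bloch_sup f) in Hub.
destruct (bloch_sup f) as [M| |].
- exists (Rabs M); split; [apply Rabs_pos|]. intros w Hw.
  eapply Rle_trans; [apply (Hub (bloch_density f w)); eauto | apply Rle_abs].
- destruct Hsup.
- exfalso. apply (Hub (bloch_density f Ci)).
  exists Ci; split; auto. unfold upper_half_plane; simpl; lra.
Qed.

(** [real] sends infinite values to 0, so finiteness has to be settled first: [B] excludes
    [p_infty], and the density at [Ci] excludes [m_infty] and gives the lower bound. *)
Lemma bloch_norm_le (f : C -> C) (B : R) :
  (forall w, upper_half_plane w -> bloch_density f w <= B) ->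
  0 <= bloch_norm f <= B.
Proof.
intros HB. unfold bloch_norm, bloch_sup.
destruct (Lub_Rbar_correct (fun x => exists w, upper_half_plane w /\ x = bloch_density f w))
  as [Hub Hlub].
specialize (Hlub (Finite B)).
assert (Hi : upper_half_plane Ci) by (unfold upper_half_plane; simpl; lra).
specialize (Hub (bloch_density f Ci) (ex_intro _ Ci (conj Hi eq_refl))).
assert (H0 : 0 <= bloch_density f Ci).
{ apply Rmult_le_pos; [simpl; lra | apply Cmod_ge_0]. }
assert (HlB : Rbar_le (Lub_Rbar (fun x => exists w, upper_half_plane w /\ x = bloch_density f w))
   (Finite B)).
{ apply Hlub. intros x [w [Hw ->]]. simpl; auto. }
destruct (Lub_Rbar _); simpl in *; [lra | contradiction | contradiction].
Qed.

(* The disc of radius [Im w / 2] around [w] stays at height at least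
   [Im w / 2], where [f] is Lipschitz with constant of order [M / Im w]. *)
Lemma derive_translation_increment (f : C -> C) (M s t : R) (w : C) :
  analytic_on_U f -> 0 <= M ->
  (forall v, upper_half_plane v -> bloch_density f v <= M) ->
  upper_half_plane w ->
  Im w * Cmod (C_derive f (w - RtoC s) - C_derive f (w - RtoC t))%C
    <= 32 * M * Rabs (s - t) / Im w.
Proof.
intros Hf HM HB Hw. unfold upper_half_plane in Hw.
set (h := fun v => (f (v - RtoC s) - f (v - RtoC t))%C).
(* At height at least [Im w / 2] the derivative is bounded by [2 * M / Im w]; the horizontal
   increment doubles this. *)
set (K := 4 * M / Im w * Rabs (s - t)).
assert (Hdisc : forall v, Cmod (v - w)%C <= Im w / 2 -> Im w / 2 <= Im v).
{ intros v Hv. assert (H := Rabs_Im_le_Cmod (v - w)%C).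
  replace (Im (v - w)%C) with (Im v - Im w) in H by (destruct v, w; reflexivity).
  assert (H' := Rle_trans _ _ _ H Hv). apply Rabs_le_between in H'. lra. }
assert (Hder : forall v, upper_half_plane v -> is_derive h v
  (C_derive f (v - RtoC s) - C_derive f (v - RtoC t))%C).
{ intros v Hv.
  apply (is_derive_minus (K := C_AbsRing) (V := C_NormedModule)
    (translation s f) (translation t f)); now apply is_derive_translation. }
assert (HK : forall v, Cmod (v - w)%C <= Im w / 2 -> Cmod (h v) <= K).
{ intros v Hv. apply Hdisc in Hv. destruct v as [x y]; simpl in Hv.
  assert (Hv' : forall x, upper_half_plane (x, y)) by (intros x'; unfold upper_half_plane; simpl; lra).
  unfold h, K.
  replace ((x, y) - RtoC s)%C with (x - s, y) by (apply injective_projections; simpl; ring).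
  replace ((x, y) - RtoC t)%C with (x - t, y) by (apply injective_projections; simpl; ring).
  replace (4 * M / Im w * Rabs (s - t))
    with (2 * (2 * M / Im w) * Rabs ((x - s) - (x - t))).
  - apply Cmod_horizontal_increment. intros x'; split; [now apply Hf|].
    assert (Hd := HB _ (Hv' x')). unfold bloch_density in Hd; simpl in Hd.
    apply Rle_div_r; [lra|].
    assert (H0 := Cmod_ge_0 (C_derive f (x', y))). nra.
  - replace (x - s - (x - t)) with (t - s) by ring. rewrite Rabs_minus_sym.
    field. lra. }
(* Cauchy's estimate on radius [Im w / 2], with [2 * K] bounding [h v - h w] by the triangle
   inequality; this produces the constant 32. *)
assert (HE : Cmod (C_derive f (w - RtoC s) - C_derive f (w - RtoC t))%C
             <= 2 * (2 * K) / (Im w / 2)).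
{ apply (cauchy_estimate h w); [lra | | |].
  - intros v Hv. eexists. apply Hder. unfold upper_half_plane. specialize (Hdisc v Hv). lra.
  - intros v Hv. assert (H1 := HK v Hv).
    assert (H2 : Cmod (h w) <= K).
    { apply HK. replace (w - w)%C with (RtoC 0) by ring. rewrite Cmod_0. lra. }
    assert (H3 := Cmod_triangle (h v) (- h w)%C). rewrite Cmod_opp in H3.
    unfold Cminus. lra.
  - now apply Hder. }
apply (Rmult_le_compat_l (Im w)) in HE; [|lra].
eapply Rle_trans; [exact HE|]. right. unfold K. field. lra.
Qed.

(** Shared by [translation t f] and [translation_i t f], which differ by a constant. Density,
    seminorm and little Bloch condition see only the derivative, so both groups are treated at
    once. *)
Definition has_translated_derivative (t : R) (f F : C -> C) : Prop :=
  forall w, upper_half_plane w -> is_derive F w (C_derive f (w - RtoC t)%C).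

Lemma bloch_density_translated (t : R) (f F : C -> C) (w : C) :
  has_translated_derivative t f F -> upper_half_plane w ->
  bloch_density F w = bloch_density f (w - RtoC t)%C.
Proof.
intros H Hw. unfold bloch_density.
now rewrite (is_C_derive_unique _ _ _ (H w Hw)), Im_translation.
Qed.

(** A horizontal translation permutes the half plane and preserves heights, so both suprema run over
    the same set of values. *)
Lemma bloch_sup_translated (t : R) (f F : C -> C) :
  has_translated_derivative t f F -> bloch_sup F = bloch_sup f.
Proof.
intros H. apply Lub_Rbar_eqset. intros x; split.
- intros [w [Hw ->]]. exists (w - RtoC t)%C; split.
  + now apply upper_half_plane_translation.
  + now apply bloch_density_translated.
- intros [w [Hw ->]]. exists (w - RtoC (- t))%C.
  assert (Hw' := upper_half_plane_translation w (- t) Hw).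
  split; auto.
  rewrite (bloch_density_translated t f F); auto.
  f_equal. rewrite RtoC_opp. ring.
Qed.

Lemma little_bloch_translated (t : R) (f F : C -> C) :
  has_translated_derivative t f F -> little_bloch f -> little_bloch F.
Proof.
intros H [[Hf Hsup] Hlim]. split; [split|].
- intros w Hw. eexists. now apply H.
- now rewrite (bloch_sup_translated t f).
- intros eps Heps. destruct (Hlim eps Heps) as [d [Hd H']].
  exists d; split; auto. intros w Hw.
  rewrite (bloch_density_translated t f F); auto; [|apply Hw].
  apply H'. now rewrite Im_translation.
Qed.

Lemma translated_continuous (f : C -> C) (F : R -> C -> C) (t0 : R) :
  little_bloch f -> (forall t, has_translated_derivative t f (F t)) ->
  filterlim (fun t => bloch_norm (fun w => (F t w - F t0 w)%C)) (locally t0) (locally 0).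
Proof.
intros [Hbl Hlim] HF.
destruct (bloch_density_bounded f Hbl) as [M [HM HB]].
apply filterlim_locally. intros [eps Heps].
destruct (Hlim (eps / 4) ltac:(lra)) as [d [Hd Hsmall]].
(* Chosen so that [32 * M * Rabs (t - t0) / Im w] is at most [eps / 2] once [Im w >= d]; [M + 1]
   covers [M = 0]. *)
assert (He : 0 < eps * d / (64 * (M + 1))).
{ apply Rdiv_lt_0_compat; [now apply Rmult_lt_0_compat | lra]. }
exists (mkposreal _ He). intros t Ht.
change (Rabs (t - t0) < eps * d / (64 * (M + 1))) in Ht.
apply Rlt_div_r in Ht; [|lra].
(* The supremum preserves only weak inequalities, so the pointwise target is [eps / 2]; below height
   [d] it is the sum of two terms under [eps / 4]. *)
assert (Hn : 0 <= bloch_norm (fun w => (F t w - F t0 w)%C) <= eps / 2).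
{ apply bloch_norm_le. intros w Hw. unfold bloch_density.
  assert (HD : is_derive (fun v : C => F t v - F t0 v)%C w
    (C_derive f (w - RtoC t) - C_derive f (w - RtoC t0))%C).
  { apply (is_derive_minus (K := C_AbsRing) (V := C_NormedModule) (F t) (F t0));
      now apply HF. }
  rewrite (is_C_derive_unique _ _ _ HD).
  destruct (Rlt_or_le (Im w) d) as [Hlow|Hhigh].
  - assert (S1 := Hsmall (w - RtoC t)%C). assert (S2 := Hsmall (w - RtoC t0)%C).
    unfold bloch_density in S1, S2. rewrite Im_translation in S1, S2.
    specialize (S1 (conj Hw Hlow)). specialize (S2 (conj Hw Hlow)).
    assert (H3 := Cmod_triangle (C_derive f (w - RtoC t)) (- C_derive f (w - RtoC t0))%C).
    rewrite Cmod_opp in H3. unfold Cminus at 1. unfold upper_half_plane in Hw.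
    apply (Rmult_le_compat_l (Im w)) in H3; lra.
  - eapply Rle_trans; [apply (derive_translation_increment f M); auto; apply Hbl|].
    apply Rle_div_l; [exact Hw|].
    assert (Ha := Rabs_pos (t - t0)).
    assert (eps / 2 * d <= eps / 2 * Im w) by (apply Rmult_le_compat_l; lra).
    nra. }
change (Rabs (bloch_norm (fun w => (F t w - F t0 w)%C) - 0) < eps).
rewrite Rminus_0_r, Rabs_pos_eq; lra.
Qed.

Lemma translation_derivative (t : R) (f : C -> C) :
  analytic_on_U f -> has_translated_derivative t f (translation t f).
Proof. intros Hf w Hw. now apply is_derive_translation. Qed.

Lemma translation_i_derivative (t : R) (f : C -> C) :
  analytic_on_U f -> has_translated_derivative t f (translation_i t f).
Proof.
intros Hf w Hw.
replace (C_derive f (w - RtoC t)%C) with (C_derive f (w - RtoC t) - 0)%C by ring.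
apply (is_derive_minus (K := C_AbsRing) (V := C_NormedModule)
  (translation t f) (fun _ => translation t f Ci)).
- now apply is_derive_translation.
- apply (is_derive_const (K := C_AbsRing) (V := C_NormedModule)).
Qed.

(** The first group acts on functions normalized at [Ci], the second is plain translation on the
    little Bloch space with its seminorm. *)
Theorem theorem3p6 :
  strongly_continuous_isometry_group little_bloch_i bloch_norm translation_i /\
  strongly_continuous_isometry_group little_bloch bloch_norm translation.
Proof.
assert (Hi : upper_half_plane Ci) by (unfold upper_half_plane; simpl; lra).
assert (H0 : forall w : C, (w - RtoC 0 = w)%C) by (intros w; ring).
assert (Hadd : forall (s t : R) (w : C), (w - RtoC (s + t) = w - RtoC s - RtoC t)%C).
{ intros s t w. rewrite RtoC_plus. ring. }
split; split.
- intros t f [Hf _]. split.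
  + eapply little_bloch_translated; [apply translation_i_derivative, Hf | exact Hf].
  + unfold translation_i. ring.
- intros t f g _ _ H w Hw. unfold translation_i, translation.
  now rewrite !H by now apply upper_half_plane_translation.
- intros t a b f g _ _ w _. unfold translation_i, translation. ring.
(* At time 0 the operator subtracts [f Ci], which is zero by the normalization. *)
- intros f [_ Hf] w _. unfold translation_i, translation. rewrite !H0, Hf. ring.
(* The constant subtracted by the inner operator occurs in both terms of the outer difference and
   cancels. *)
- intros s t f _ w _. unfold translation_i, translation. rewrite !Hadd. ring.
- intros t f [Hf _]. unfold bloch_norm.
  now rewrite (bloch_sup_translated t f) by apply translation_i_derivative, Hf.
- intros f t0 [Hf _]. apply (translated_continuous f (fun t => translation_i t f)); auto.
  intros t; apply translation_i_derivative, Hf.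
- intros t f Hf. eapply little_bloch_translated; [apply translation_derivative, Hf | exact Hf].
- intros t f g _ _ H w Hw. unfold translation.
  now apply H, upper_half_plane_translation.
- intros t a b f g _ _ w _. reflexivity.
- intros f _ w _. unfold translation. now rewrite H0.
- intros s t f _ w _. unfold translation. now rewrite Hadd.
- intros t f Hf. unfold bloch_norm.
  now rewrite (bloch_sup_translated t f) by apply translation_derivative, Hf.
- intros f t0 Hf. apply (translated_continuous f (fun t => translation t f)); auto.
  intros t; apply translation_derivative, Hf.
Qed.
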